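(* Let $\mathbb A$ be a finite algebra. Then either $\mathbb A$ has the polynomially generated powers (PGP) property, or $\mathbb A$ has the exponentially generated powers (EGP) property.
   Context: A finite algebra $\mathbb A$ is a finite nonempty set $A$ together with a (possibly infinite) family of finitary operations $f\colon A^{s}\to A$, all of arity $s\ge 1$. The power $\mathbb A^{n}$ ($n\ge 1$) has universe $A^n$, with operations acting coordinatewise; it is generated by a set $X\subseteq A^n$ if the smallest subset of $A^n$ containing $X$ and closed under all (coordinatewise) operations is $A^n$. PGP: $\mathbb A$ has the polynomially generated powers (PGP) property if there exists a polynomial $p$ such that for every $n\ge 1$ the power $\mathbb A^{n}$ can be generated by at most $p(n)$ tuples. EGP: $\mathbb A$ has the exponentially generated powers (EGP) property if there exist real numbers $b>1$ and $C>0$ such that for every $n\ge 1$ the power $\mathbb A^{n}$ cannot be generated by less than $C b^{n}$ tuples. *)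

(* Defs.v *)
From mathcomp Require Import all_boot all_order all_algebra.
From mathcomp Require Import boolp classical_sets reals.

Set Implicit Arguments.
Unset Strict Implicit.
Unset Printing Implicit Defensive.

Import Order.TTheory GRing.Theory Num.Theory.

(* The family of basic operations is indexed by an arbitrary, possibly
   infinite, type; [A^s] is represented by [{ffun 'I_s -> A}]. *)
Record finAlgebra := FinAlgebra {
  carrier :> finType;
  carrier_gt0 : (0 < #|carrier|)%N;
  op_index : Type;
  arity : op_index -> nat;
  arity_gt0 : forall i, (0 < arity i)%N;
  op : forall i, {ffun 'I_(arity i) -> carrier} -> carrier
}.

Local Open Scope classical_set_scope.
Local Open Scope ring_scope.

Definition power (A : finAlgebra) (n : nat) : finType := {ffun 'I_n -> A}.

Definition power_op (A : finAlgebra) (n : nat) (i : op_index A)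
    (t : 'I_(arity i) -> power A n) : power A n :=
  [ffun k => op [ffun j => t j k]].

Definition op_closed (A : finAlgebra) (n : nat) (S : set (power A n)) : Prop :=
  forall (i : op_index A) (t : 'I_(arity i) -> power A n),
    (forall j, S (t j)) -> S (power_op t).

Definition generates (A : finAlgebra) (n : nat) (X : {set power A n}) : Prop :=
  smallest (@op_closed A n) [set` X] = setT.

Definition PGP (R : realType) (A : finAlgebra) : Prop :=
  exists p : {poly R}, forall n : nat, (0 < n)%N ->
    exists X : {set power A n}, generates X /\ #|X|%:R <= p.[n%:R].

Definition EGP (R : realType) (A : finAlgebra) : Prop :=
  exists b C : R, [/\ 1 < b, 0 < C &
    forall n : nat, (0 < n)%N ->
      ~ exists X : {set power A n}, generates X /\ #|X|%:R < C * b ^+ n].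

(* Main.v *)
(* Index tuples by I = ('I_M * bool) + A and ask whether A^I is generated by the
   tuples that take equal values at (k, false) and (k, true) for some k.
   If this holds for some M, then in a tuple of A^n made of at least 2M constant
   blocks one pairs up the first 2M blocks, sends the other blocks to the part A
   of I, and pulls back the generation of A^I: the tuple is generated by tuples
   with one block less. Hence tuples with at most 2M blocks generate A^n, and
   there are polynomially many of them.
   If it fails for all M, choose at random a pair of distinct coordinates in
   each of M disjoint sets of |A| + 1 coordinates of A^n. By the pigeonhole
   principle, a tuple is nonconstant on all the M pairs with probability at most
   (1 - 1 / (|A| (|A| + 1)))^M, so for a set X smaller than the inverse of this
   bound some choice makes every member of X constant on some chosen pair;
   projecting A^n onto A^I shows that X does not generate A^n. *)
Require Import Defs.
From mathcomp Require Import all_boot all_order all_algebra.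
From mathcomp Require Import boolp classical_sets reals.
From mathcomp Require Import zify lra.

Set Implicit Arguments.
Unset Strict Implicit.
Unset Printing Implicit Defensive.

Import Order.TTheory GRing.Theory Num.Theory.

(** * Counting lemmas *)

Lemma card_ord_lt n m : (m <= n)%N -> #|[set i : 'I_n | (i < m)%N]| = m.
Proof.
move=> le_mn; pose f (i : 'I_m) := widen_ord le_mn i.
have f_inj : injective f by move=> i j /(congr1 val) /= /val_inj.
rewrite -[RHS]card_ord -(card_imset _ f_inj).
apply: eq_card => i; rewrite inE; apply/idP/imsetP => [lt_im|[j _ ->]].
  by exists (Ordinal lt_im) => //; apply: val_inj.
exact: (ltn_ord j).
Qed.

(** Union bound: by pigeonhole each [y] excludes at most [(q.+1 * q).-1 ^ M] choices of [s], so the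
    excluded sets cannot cover all choices. A pair [(i, l)] encodes the distinct positions [i] and
    [lift i l]. *)
Lemma equal_pairs_exist (T Y : finType) q M (X : {set Y})
    (x : Y -> 'I_M -> 'I_q.+1 -> T) :
  (#|T| <= q)%N -> (#|X| * (q.+1 * q).-1 ^ M < (q.+1 * q) ^ M)%N ->
  exists s : 'I_M -> 'I_q.+1 * 'I_q, forall y, y \in X ->
    exists k, x y k (s k).1 = x y k (lift (s k).1 (s k).2).
Proof.
move=> leTq ltX.
pose eqp y k (p : 'I_q.+1 * 'I_q) := x y k p.1 == x y k (lift p.1 p.2).
pose bad y := [set s : {ffun 'I_M -> 'I_q.+1 * 'I_q} | [forall k, ~~ eqp y k (s k)]].
have card_bad y : (#|bad y| <= (q.+1 * q).-1 ^ M)%N.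
  have -> : bad y = setXn (fun k => [set p | ~~ eqp y k p]).
    apply/setP => s; rewrite inE in_setXn; apply: eq_forallb => k.
    by rewrite inE.
  rewrite cardsXn -[M in leqRHS]card_ord -prod_nat_const; apply: leq_prod => k _.
  have /injectivePn [i [j neq_ij eq_ij]] : ~~ injectiveb (x y k).
    apply/injectiveP => /leq_card; rewrite card_ord => ltqT.
    by have := leq_trans ltqT leTq; rewrite ltnn.
  have [l jE|jE] := unliftP i j; last by rewrite jE eqxx in neq_ij.
  suff : [set p | ~~ eqp y k p] \proper [set: 'I_q.+1 * 'I_q].
    by move/proper_card; rewrite cardsT card_prod !card_ord; case: (q.+1 * q)%N.
  rewrite finset.properEneq finset.subsetT andbT; apply/eqP => /setP/(_ (i, l)).
  by rewrite !inE /eqp /= -jE eq_ij eqxx.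
have [s sP] : exists s, s \notin \bigcup_(y in X) bad y.
  apply/existsP; rewrite -negb_forall; apply: contraTN ltX => /forallP allbad.
  rewrite -leqNgt -[leqLHS](_ : #|{ffun 'I_M -> 'I_q.+1 * 'I_q}| = _); last first.
    by rewrite card_ffun card_prod !card_ord.
  have -> : #|{ffun 'I_M -> 'I_q.+1 * 'I_q}| = #|\bigcup_(y in X) bad y|.
    by apply: eq_card => s; rewrite allbad.
  rewrite -sum_nat_const.
  apply: (big_ind2 (fun (B : {set _}) n => (#|B| <= n)%N)) => [|B1 n1 B2 n2 le1 le2|//].
    by rewrite cards0.
  by rewrite (leq_trans (leq_card_setU _ _)) ?leq_add.
exists s => y yX; have : s \notin bad y.
  by apply: contra sP => sy; apply/bigcupP; exists y.
by rewrite inE negb_forall => /existsP [k /negPn /eqP]; exists k.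
Qed.

(** * Generation over arbitrary finite index sets *)

Section Span.
Variable A : finAlgebra.

Inductive span (I : finType) (S : {ffun I -> A} -> Prop) :
    {ffun I -> A} -> Prop :=
| span_gen x : S x -> span S x
| span_op (i : op_index A) (t : 'I_(arity i) -> {ffun I -> A}) :
    (forall j, span S (t j)) -> span S [ffun k => op [ffun j => t j k]].

(** Precomposition with [phi] is a homomorphism from the power over [I] to the power over [J]. *)
Lemma span_reindex (I J : finType) (phi : J -> I) (S : {ffun I -> A} -> Prop)
    (S' : {ffun J -> A} -> Prop) (x : {ffun I -> A}) :
  (forall y, S y -> span S' [ffun j => y (phi j)]) ->
  span S x -> span S' [ffun j => x (phi j)].
Proof.
move=> SS'; elim=> [y /SS' //|i t _ IH].
have -> : [ffun j => [ffun k => op [ffun l => t l k]] (phi j)] =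
    [ffun k => op [ffun l => [ffun j => t l (phi j)] k]].
  apply/ffunP => j; rewrite !ffunE; congr op.
  by apply/ffunP => l; rewrite !ffunE.
exact: span_op IH.
Qed.

Lemma span_trans (I : finType) (S S' : {ffun I -> A} -> Prop) x :
  (forall y, S y -> span S' y) -> span S x -> span S' x.
Proof. by move=> SS'; elim=> [y /SS' //|i t _ IH]; exact: span_op. Qed.

Lemma generatesP n (X : {set power A n}) :
  generates X <-> forall x, span (fun y => y \in X) x.
Proof.
split=> [genX x|spanX].
  have: (smallest (@op_closed A n) [set` X])%classic x by rewrite genX.
  apply; split=> [i t|y /=]; [exact: span_op|exact: span_gen].
rewrite /generates -subTset => x _ B [Bop XB].
by elim: (spanX x) => [y /XB //|i t _ IH]; apply: Bop.
Qed.

(** All arities are positive, so nothing is generated from the empty set. *)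
Lemma span_inh (I : finType) (S : {ffun I -> A} -> Prop) x :
  span S x -> exists y, S y.
Proof.
elim=> [y Sy|i t _ IH]; first by exists y.
exact: IH (Ordinal (arity_gt0 i)).
Qed.

(** * Tuples with few constant blocks *)

Definition pair_index (M : nat) : finType := (('I_M * bool) + A)%type.

Definition has_equal_pair M (x : {ffun pair_index M -> A}) : Prop :=
  exists k : 'I_M, x (inl (k, false)) = x (inl (k, true)).

Definition pair_spanned M : Prop := forall x, span (@has_equal_pair M) x.

(** At most [K] constant blocks: [h j] is the block of coordinate [j], and some blocks may be
    empty. *)
Definition step_tuple N K (x : power A N) : Prop :=
  exists (h : 'I_N -> nat) (v : nat -> A),
    [/\ {homo h : i j / (i <= j)%N}, forall j, (h j < K)%N
      & forall j, x j = v (h j)].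

Lemma step_tuple_size N (x : power A N) : step_tuple N x.
Proof.
have [a _] : exists a : A, a \in predT by apply/card_gt0P; exact: carrier_gt0.
exists val, (fun j => if insub j is Some k then x k else a).
by split=> [|j|j] //; [exact: (ltn_ord j)|rewrite valK].
Qed.

Lemma step_tuple_reduce M N K (x : power A N) :
  pair_spanned M -> (2 * M <= K.+1)%N -> step_tuple K.+1 x ->
  span (step_tuple K) x.
Proof.
move=> spM leMK [h [v [hmono hK xE]]].
pose chi r : pair_index M :=
  if insub r./2 is Some k then inl (k, odd r) else inr (v r).
pose b : {ffun pair_index M -> A} :=
  [ffun c : pair_index M =>
    match c : (('I_M * bool) + A)%type with
    | inl (k, e) => v (e + k.*2)%N | inr a => a end].
have -> : x = [ffun j => b (chi (h j))].
  apply/ffunP => j; rewrite !ffunE xE /chi; case: insubP => //= k _ ->.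
  by rewrite odd_double_half.
apply: span_reindex (spM b) => y [k yk]; apply: span_gen.
have kM := ltn_ord k.
have chiE (e : bool) : chi (e + k.*2)%N = inl (k, e).
  rewrite /chi; have -> : ((e + k.*2)./2 = k)%N by case: e; lia.
  by rewrite valK oddD odd_double addbF; case: e.
(* [unbump] merges blocks [2k] and [2k+1], on which [y] agrees; [bump] skips [2k], so the merged
   block takes its value from [2k+1]. *)
exists (fun j => unbump k.*2 (h j)), (fun r => y (chi (bump k.*2 r))).
split=> [i j /hmono|j|j]; rewrite /unbump.
- by case: ltnP; case: ltnP; lia.
- by have := hK j; case: ltnP; lia.
rewrite ffunE; have [hjk|hjk] := eqVneq (h j) k.*2; last first.
  congr (y (chi _)); rewrite /bump; move: hjk.
  by case: ltnP => /=; lia.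
rewrite hjk ltnn subn0 /bump leqnn.
by have := chiE false; have := chiE true; rewrite /= => -> ->.
Qed.

Lemma step_tuple_span M N : pair_spanned M ->
  forall x : power A N, span (step_tuple (2 * M)) x.
Proof.
move=> spM x; suff H d : step_tuple (2 * M + d) x -> span (step_tuple (2 * M)) x.
  have [leNM|ltMN] := leqP N (2 * M).
    have [h [v [hm hN xE]]] := step_tuple_size x.
    apply: span_gen; exists h, v; split=> // j; exact: leq_trans (hN j) leNM.
  by apply: (H (N - 2 * M)%N); rewrite subnKC 1?ltnW //; exact: step_tuple_size.
elim: d x => [|d IH] x; first by rewrite addn0; exact: span_gen.
rewrite addnS => /(step_tuple_reduce spM)/span_trans; apply=> //.
by lia.
Qed.

(** The block of [j] is the number of thresholds [c i] that are at most [j]; the threshold [N] is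
    never reached. *)
Definition step_decode N K (c : {ffun 'I_K -> 'I_N.+1})
    (v : {ffun 'I_K.+1 -> A}) : power A N :=
  [ffun j : 'I_N => v (inord #|[set i : 'I_K | (c i <= j)%N]|)].

Lemma step_tuple_decode N K (x : power A N) :
  step_tuple K x -> exists c v, x = step_decode (K := K) c v.
Proof.
case=> h [v [hmono hK xE]].
(* Since [h] is monotone, the coordinates counted form an initial segment, so [c i] is the first
   position after block [i]. *)
pose c i := #|[set j : 'I_N | (h j <= i)%N]|.
have cN i : (c i < N.+1)%N by rewrite ltnS -[leqRHS]card_ord max_card.
have cP (i : nat) (j : 'I_N) : (c i <= j)%N = (i < h j)%N.
  have jN := ltn_ord j.
  apply/idP/idP => [|ij].
    apply: contraTltn => hji; rewrite -ltnNge -[leqLHS](card_ord_lt (ltn_ord j)).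
    rewrite /c; apply: subset_leq_card; apply/fintype.subsetP => l; rewrite !inE ltnS => /hmono.
    by move=> hl; apply: leq_trans hl hji.
  rewrite -[leqRHS](card_ord_lt (ltnW jN)).
  rewrite /c; apply: subset_leq_card; apply/fintype.subsetP => l; rewrite !inE => hl.
  by rewrite ltnNge; apply/negP => /hmono; lia.
exists [ffun i : 'I_K => Ordinal (cN i)], [ffun r : 'I_K.+1 => v r].
apply/ffunP => j; rewrite xE !ffunE; congr v.
have hjK := ltnW (hK j).
have -> : #|[set i : 'I_K | ([ffun i : 'I_K => Ordinal (cN i)] i <= j)%N]| = h j.
  rewrite -[RHS](card_ord_lt hjK).
  by apply: eq_card => i; rewrite !inE ffunE /= cP.
by rewrite inordK.
Qed.

Lemma pair_spanned_small_generators M N : pair_spanned M ->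
  exists X : {set power A N}, generates X /\
    (#|X| <= N.+1 ^ (2 * M) * #|A| ^ (2 * M).+1)%N.
Proof.
move=> spM; set K := (2 * M)%N.
pose X := [set step_decode p.1 p.2 |
             p : {ffun 'I_K -> 'I_N.+1} * {ffun 'I_K.+1 -> A}].
exists X; split.
  apply/generatesP => x; apply: span_trans (step_tuple_span spM x) => y.
  move=> /step_tuple_decode [c [v ->]]; apply: span_gen.
  by apply/imsetP; exists (c, v).
by rewrite (leq_trans (leq_imset_card _ _)) // card_prod !card_ffun !card_ord.
Qed.

(** * Lower bound on generating sets *)

Lemma generators_lower_bound M N (X : {set power A N}) (q := #|A|) :
  ~ pair_spanned M -> (M * q.+1 + q <= N)%N -> generates X ->
  ((q.+1 * q) ^ M <= #|X| * (q.+1 * q).-1 ^ M)%N.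
Proof.
move=> nspM leN /generatesP genX; rewrite leqNgt; apply/negP => ltX.
apply: nspM.
have leI : (#|{: ('I_M * 'I_q.+1) + A}| <= N)%N.
  by rewrite card_sum card_prod !card_ord.
pose e (c : ('I_M * 'I_q.+1) + A) : 'I_N := widen_ord leI (enum_rank c).
have e_inj : injective e by move=> c d /(congr1 val) /= /val_inj/enum_rank_inj.
pose xe (y : power A N) k i := y (e (inl (k, i))).
have [s sP] := equal_pairs_exist xe (leqnn q) ltX.
pose phi (c : pair_index M) : 'I_N :=
  match c : (('I_M * bool) + A)%type with
  | inl (k, t) => e (inl (k, if t then lift (s k).1 (s k).2 else (s k).1))
  | inr a => e (inr a)
  end.
have phi_inj : injective phi.
  case=> [[k t]|a] [[l u]|b] /e_inj // [] => [<-|-> //].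
  by case: t u => [] [] // /eqP; rewrite ?(negPf (neq_lift _ _)) 1?eq_sym
    ?(negPf (neq_lift _ _)).
have [a0 _] : exists a : A, a \in predT by apply/card_gt0P; exact: carrier_gt0.
move=> x.
(* As [phi] is injective, [x] extends to all [N] coordinates, with [a0] off the image. *)
pose z : power A N := [ffun j => if [pick c | phi c == j] is Some c then x c else a0].
have -> : x = [ffun c => z (phi c)].
  apply/ffunP => c; rewrite !ffunE; case: pickP => [d /eqP/phi_inj -> //|].
  by move/(_ c); rewrite eqxx.
apply: span_reindex (genX z) => y /sP [k yk]; apply: span_gen.
by exists k; rewrite !ffunE.
Qed.

End Span.

(** * Growth rates *)

Local Open Scope ring_scope.

(** Induction on [n]: with [y] midway between 1 and [x], the first [n] factors contribute at most
    [y] and the last at most [x / y]. *)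
Lemma root_gt1 (R : realFieldType) (n : nat) (x : R) :
  1 < x -> exists2 b, 1 < b & b ^+ n <= x.
Proof.
elim: n x => [|n IH] x x1; first by exists 2; rewrite ?expr0; lra.
pose y := (1 + x) / 2; have y1 : 1 < y by rewrite /y; lra.
have [b b1 bn] := IH y y1.
exists (Num.min b (x / y)).
  by rewrite lt_min b1 ltr_pdivlMr ?mul1r /y; lra.
have m0 : 0 <= Num.min b (x / y) by rewrite le_min !divr_ge0 //=; lra.
rewrite exprSr -[leRHS](@divfK _ y) 1?mulrC; last by lra.
apply: ler_pM; rewrite ?exprn_ge0 ?ge_min ?lexx ?orbT //.
by apply: le_trans bn; rewrite lerXn2r ?nnegrE ?ge_min ?lexx //; lra.
Qed.

Lemma pair_spanned_PGP (R : realType) (A : finAlgebra) M :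
  pair_spanned A M -> PGP R A.
Proof.
move=> spM.
exists ((#|A| ^ (2 * M).+1)%:R *: ('X + 1) ^+ (2 * M)) => n _.
have [X [genX leX]] := pair_spanned_small_generators n spM.
by exists X; split=> //; rewrite !hornerE natr1 -natrX -natrM ler_nat mulnC.
Qed.

Lemma never_pair_spanned_EGP (R : realType) (A : finAlgebra) :
  (forall M, ~ pair_spanned A M) -> EGP R A.
Proof.
move=> nsp; set q := #|A|; set p := (q.+1 * q)%N.
have q0 : (0 < q)%N := carrier_gt0 A.
have p1 : (1 < p)%N by rewrite /p; nia.
pose beta : R := p%:R / p.-1%:R.
have pm0 : 0 < p.-1%:R :> R by rewrite ltr0n; lia.
have beta1 : 1 < beta by rewrite ltr_pdivlMr // mul1r ltr_nat; lia.
have beta0 : 0 < beta by lra.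
have [b b1 bq] := root_gt1 q.+1 beta1.
have b0 : 0 <= b by lra.
(* The factor [beta ^- 2] absorbs the rounding in [M], since [n] is at most [q.+1 * M.+2]. *)
exists b, (beta ^- 2); split; rewrite ?invr_gt0 ?exprn_gt0 // => n n0 [X [genX]].
apply/negP; rewrite -leNgt mulrC ler_pdivrMr ?exprn_gt0 //.
pose M := ((n - q) %/ q.+1)%N.
have nM : (n <= q.+1 * M.+2)%N.
  by have := ltn_ceil (n - q) (ltn0Sn q); rewrite -/M; lia.
have le_n : b ^+ n <= beta ^+ M * beta ^+ 2.
  rewrite -exprD addn2; apply: le_trans (_ : b ^+ (q.+1 * M.+2) <= _).
    by rewrite ler_weXn2l // ltW.
  by rewrite exprM lerXn2r ?nnegrE ?exprn_ge0 // ltW.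
apply: le_trans le_n _; rewrite ler_pM2r ?exprn_gt0 //.
(* For [n < q] there is no room for the part [A]; then [M = 0] and [X] only has to be nonempty. *)
have [ltnq|leqn] := ltnP n q.
  rewrite /M (_ : n - q = 0)%N ?div0n ?expr0 ?ler1n; last by lia.
  have [x _] : exists x : power A n, x \in predT.
    by apply/card_gt0P; rewrite card_ffun expn_gt0 q0.
  by have /generatesP/(_ x)/span_inh [y yX] := genX; apply/card_gt0P; exists y.
rewrite expr_div_n ler_pdivrMr ?exprn_gt0 // -!natrX -natrM ler_nat.
apply: generators_lower_bound (nsp M) _ genX.
by have := leq_trunc_div (n - q) q.+1; rewrite -/M -/q; lia.
Qed.

Theorem theorem1 (R : realType) (A : finAlgebra) : PGP R A \/ EGP R A.
Proof.
have [[M spM]|nsp] := pselect (exists M, pair_spanned A M).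
  by left; exact: pair_spanned_PGP spM.
by right; apply: never_pair_spanned_EGP => M spM; apply: nsp; exists M.
Qed.
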